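(* For each integer $n\geq 1$ and each Mostowski-Rabin index $(\iota,\kappa)$ such that $(0,2)\sqsubseteq(\iota,\kappa)$ or $(\iota,\kappa)=(1,3)=\overline{(0,2)}$, the $D_{\omega^n}(\boldsymbol{\Sigma}^1_1)$-complete tree language $\mathcal{L}_n$ is Wadge reducible to the game tree language $W_{(\iota,\kappa)}$, i.e. $\mathcal{L}_n\leq_W W_{(\iota,\kappa)}$. In particular, the language $W_{(\iota,\kappa)}$ is not in any class $D_\alpha(\boldsymbol{\Sigma}^1_1)$ for $\alpha<\omega^\omega$.
   Context: **Trees.** For a finite alphabet $\Sigma$, $T_\Sigma^\omega$ is the set of all functions $t:\{l,r\}^\star\to\Sigma$ (infinite binary trees labelled in $\Sigma$; the root is the empty word $\lambda$). For $u\in\{l,r\}^\star$, $t_u\in T_\Sigma^\omega$ is the subtree $t_u(v)=t(u\cdot v)$. A path of $t$ is an infinite sequence $t(u_0)t(u_1)\cdots$ of labels along an infinite branch, where $u_0=\lambda$ and $u_{i+1}\in\{u_il,u_ir\}$ for all $i$. **Topology.** $\Sigma^\omega$ (infinite words) and $T_\Sigma^\omega$ carry the Cantor (product of discrete) topology. $\boldsymbol{\Sigma}^1_1$ is the class of analytic sets. **Difference hierarchy.** A countable ordinal is even if it is of the form $\gamma+m$ with $\gamma$ equal to $0$ or a limit ordinal and $m$ an even non-negative integer; otherwise it is odd. For an ordinal $\eta<\omega_1$ and an increasing sequence $(A_\theta)_{\theta<\eta}$ of subsets of a space $X$, $D_\eta[(A_\theta)_{\theta<\eta}]$ is the set of $x\in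 X$ such that $x\in A_\theta\setminus\bigcup_{\theta'<\theta}A_{\theta'}$ for some $\theta<\eta$ whose parity is opposite to that of $\eta$. For $X=\Sigma^\omega$ or $X=T_\Sigma^\omega$, $D_\eta(\boldsymbol{\Sigma}^1_1)$ is the class of all sets $D_\eta[(A_\theta)_{\theta<\eta}]$ with every $A_\theta\subseteq X$ in $\boldsymbol{\Sigma}^1_1$. **Reducibility and completeness.** $E\leq_W F$ (Wadge reducibility) means $E=f^{-1}(F)$ for some continuous function $f$ between the ambient spaces. A set $F$ (in a space $\Sigma^\omega$ or $T_\Sigma^\omega$) is $D_\eta(\boldsymbol{\Sigma}^1_1)$-complete if for every finite alphabet $Y$ and every $E\subseteq Y^\omega$: $E\in D_\eta(\boldsymbol{\Sigma}^1_1)$ iff $E\leq_W F$. **The languages $\mathcal{L}$ and $\mathcal{L}_n$.** $\mathcal{L}\subseteq T^\omega_{\{0,1\}}$ is the set of trees having at least one path containing infinitely many letters $1$. For non-negative integers write $\mathrm{Ord}(a_{n-1},\ldots,a_0)=\omega^{n-1}\cdot a_{n-1}+\cdots+\omega\cdot a_1+a_0$. For $n=1$, $$\mathcal{L}_1=\{t\in T^\omega_{\{0,1\}}\mid \exists m\geq 0\ \ t_{l^m\cdot r}\in\mathcal{L}\text{ and }\min\{m\geq 0\mid t_{l^m\cdot r}\in\mathcal{L}\}\text{ is odd}\}.$$ For $n\geq 2$, $\mathcal{L}_n$ is the set of $t\in T^\omega_{\{0,1\}}$ for which there exist integers $a_{n-1},\ldots,a_0\geq 0$ such that: (1) $t_{l^{a_{n-1}}\cdot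 r\cdot l^{a_{n-2}}\cdot r\cdots l^{a_0}\cdot r}\in\mathcal{L}$ and $\mathrm{Ord}(a_{n-1},\ldots,a_0)$ is odd; (2) for all integers $b_{n-1},\ldots,b_0\ge 0$ with $\mathrm{Ord}(b_{n-1},\ldots,b_0)<\mathrm{Ord}(a_{n-1},\ldots,a_0)$, the tree $t_{l^{b_{n-1}}\cdot r\cdot l^{b_{n-2}}\cdot r\cdots l^{b_0}\cdot r}$ is not in $\mathcal{L}$. **Mostowski-Rabin indices.** A Mostowski-Rabin index is a pair $(\iota,\kappa)$ with $\iota\in\{0,1\}$ and $\iota\leq\kappa<\omega$. The partial order is: $(\iota,\kappa)\sqsubseteq(\iota',\kappa')$ iff either $\iota'\leq\iota$ and $\kappa\leq\kappa'$, or $\iota=0$, $\iota'=1$ and $\kappa+2\leq\kappa'$. The indices $(1,m)$ and $(0,m-1)$ are dual to each other, and $\overline{(\iota,\kappa)}$ denotes the dual of $(\iota,\kappa)$. **Game tree languages $W_{(\iota,\kappa)}$.** Let $\Sigma_{(\iota,\kappa)}=\{\exists,\forall\}\times\{\iota,\ldots,\kappa\}$; for a letter $a$ write $a=(a_1,a_2)$. For $t\in T^\omega_{\Sigma_{(\iota,\kappa)}}$, the parity game $G(t)$ is played by Eve and Adam with positions $v\in\{l,r\}^\star$, starting at $\lambda$. At position $v$, Eve moves if $t(v)_1=\exists$ and Adam moves if $t(v)_1=\forall$; a move goes from $v$ to $vl$ or $vr$. Eve wins an infinite play $v_0,v_1,\ldots$ iff $\limsup_{k\to\infty}t(v_k)_2$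 is even; otherwise Adam wins. $W_{(\iota,\kappa)}\subseteq T^\omega_{\Sigma_{(\iota,\kappa)}}$ is the set of trees $t$ such that Eve has a winning strategy in $G(t)$. *)

(* Defs.v *)
From HB Require Import structures.
From mathcomp Require Import all_boot all_order all_algebra.
From mathcomp Require Import all_classical all_analysis.

Set Implicit Arguments.
Unset Strict Implicit.
Unset Printing Implicit Defensive.

Import GRing.Theory.
Local Open Scope classical_set_scope.

(* An ordinal is given as a point [eta] of a well-ordered set: it is the order
   type of the initial segment below [eta]. *)
Record wellOrder := WellOrder {
  wo_sort :> Type;
  wlt : wo_sort -> wo_sort -> Prop;
  wlt_trans : forall x y z, wlt x y -> wlt y z -> wlt x z;
  wlt_total : forall x y, [\/ wlt x y, x = y | wlt y x];
  wlt_wf : well_founded wlt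
}.
Arguments wlt {_}.

Section Parity.
Variable W : wellOrder.
Implicit Types x y z g : W.

Definition zero_or_limit g := forall y, wlt y g -> exists z, wlt y z /\ wlt z g.

Definition is_succ x y := wlt x y /\ forall z, wlt x z -> y = z \/ wlt y z.

(* x = g + m *)
Fixpoint is_plus g (m : nat) x : Prop :=
  if m is m'.+1 then exists y, is_plus g m' y /\ is_succ y x else x = g.

Definition even_ord x :=
  exists g m, [/\ zero_or_limit g, is_plus g m x & ~~ odd m].

Definition odd_ord x := ~ even_ord x.

End Parity.

(* Ordinals below omega^omega in Cantor normal form: the polynomial [p] stands
   for the ordinal sum of the omega^i * p`_i, taken by decreasing i. In
   particular 'X^n stands for omega^n. *)
Section CantorNormalForm.
Local Open Scope ring_scope.

Definition cnf_lt (p q : {poly nat}) : Prop :=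
  exists i, ((p`_i)%R < (q`_i)%R)%N /\ forall j, (i < j)%N -> p`_j = q`_j.

Lemma cnf_lt_trans p q s : cnf_lt p q -> cnf_lt q s -> cnf_lt p s.
Proof.
move=> [i [pq ipq]] [j [qs jqs]]; case: (ltngtP i j) => ij.
- exists j; split=> [|k jk]; first by rewrite ipq.
  by rewrite ipq ?jqs// (ltn_trans ij).
- exists i; split=> [|k ik]; first by rewrite -jqs.
  by rewrite ipq// jqs// (ltn_trans ij).
- rewrite -{}ij in qs jqs; exists i; split; first exact: ltn_trans pq qs.
  by move=> k ik; rewrite ipq// jqs.
Qed.

Lemma cnf_lt_total p q : [\/ cnf_lt p q, p = q | cnf_lt q p].
Proof.
suff H n : (forall j, (n <= j)%N -> p`_j = q`_j) ->
    [\/ cnf_lt p q, p = q | cnf_lt q p].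
  apply: (H (maxn (size p) (size q))) => j; rewrite geq_max => /andP[pj qj].
  by rewrite !nth_default.
elim: n => [|n IH] Hn; first by apply: Or32; apply/polyP => i; exact: Hn.
case: (ltngtP (p`_n)%R (q`_n)%R) => pq.
- by apply: Or31; exists n.
- by apply: Or33; exists n; split=> // j nj; rewrite Hn.
- by apply: IH => j; rewrite leq_eqVlt => /orP[/eqP <-//|]; exact: Hn.
Qed.

Lemma cnf_lt_wf : well_founded cnf_lt.
Proof.
suff H n : forall p : {poly nat}, (size p <= n)%N -> Acc cnf_lt p.
  by move=> p; exact: (H (size p)).
elim: n => [|n IHn].
  move=> p; rewrite leqn0 size_poly_eq0 => /eqP ->.
  by constructor => q [i []]; rewrite coef0.
have small (p : {poly nat}) : (size (take_poly n p) <= n)%N.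
  exact: size_take_poly.
have Hc c (q : {poly nat}) : Acc cnf_lt q -> forall p : {poly nat},
    (size p <= n.+1)%N -> p`_n = c -> take_poly n p = q -> Acc cnf_lt p.
  elim/ltn_ind: c q => c IHc q; elim => {}q _ IHq p sp pc qE.
  constructor => p' [i [lt_i eq_i]].
  have sp' : (size p' <= n.+1)%N.
    apply/leq_sizeP => j nj; case: (leqP j i) => [ji|ij].
      move: lt_i; rewrite [p`_i]nth_default ?ltn0//.
      exact: leq_trans sp (leq_trans nj ji).
    by rewrite eq_i// nth_default// (leq_trans sp).
  have lein : (i <= n)%N.
    rewrite leqNgt; apply/negP => ni; move: lt_i.
    by rewrite [p`_i]nth_default ?ltn0// (leq_trans sp).
  move: lein; rewrite leq_eqVlt => /orP[/eqP iE|lin].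
    apply: (IHc (p'`_n)%R _ _ (IHn _ (small p'))) => //.
    by rewrite -pc -iE.
  apply: (IHq (take_poly n p')) => //; last by rewrite eq_i.
  rewrite -qE; exists i; rewrite !coef_take_poly lin; split=> // j ij.
  by rewrite !coef_take_poly eq_i.
by move=> p sp; exact: (Hc (p`_n)%R _ (IHn _ (small p))).
Qed.

End CantorNormalForm.

Definition omega_omega : wellOrder :=
  WellOrder cnf_lt_trans cnf_lt_total cnf_lt_wf.

Definition omega_pow (n : nat) : omega_omega := ('X^n : {poly nat})%R.

(* Ord [:: a_(n-1); ...; a_0] *)
Definition Ord (a : seq nat) : omega_omega := Poly (rev a).

Definition cantor_pow (I : Type) (S : choiceType) : topologicalType :=
  prod_topology (fun _ : I => discrete_topology S).

Definition omega_words (S : choiceType) := cantor_pow nat S.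

(* Words over the directions {l, r}; the root is [::]. *)
Definition lft : bool := false.
Definition rgt : bool := true.

Definition trees (S : choiceType) := cantor_pow (seq bool) S.

Definition subtree (S : choiceType) (t : trees S) (u : seq bool) : trees S :=
  fun v => t (u ++ v).

Definition is_branch (u : nat -> seq bool) :=
  u 0 = [::] /\
  forall i, u i.+1 = rcons (u i) lft \/ u i.+1 = rcons (u i) rgt.

(* The boldface class Sigma^1_1 of a Polish space X: the projections to X of the
   closed subsets of X * N^N, N^N being the Baire space. *)
Definition analytic (X : topologicalType) (A : set X) :=
  exists2 C : set (X * omega_words nat), closed C & A = fst @` C.

Section DifferenceHierarchy.
Variables (W : wellOrder) (eta : W) (X : topologicalType).

(* Only the values A theta with theta < eta matter. *)
Definition diff_set (A : W -> set X) : set X :=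
  [set x | exists theta, [/\ wlt theta eta,
     odd_ord theta <-> even_ord eta,
     A theta x & forall theta', wlt theta' theta -> ~ A theta' x]].

Definition D_Sigma11 (E : set X) :=
  exists A : W -> set X,
    [/\ forall theta, wlt theta eta -> analytic (A theta),
        forall theta' theta, wlt theta' theta -> wlt theta eta ->
          A theta' `<=` A theta
      & E = diff_set A].

End DifferenceHierarchy.

Definition wadge_le (X Y : topologicalType) (E : set X) (F : set Y) :=
  exists2 f : X -> Y, continuous f & E = f @^-1` F.

Definition D_Sigma11_complete (W : wellOrder) (eta : W)
    (X : topologicalType) (F : set X) :=
  forall (Y : finType) (E : set (omega_words Y)),
    D_Sigma11 eta E <-> wadge_le E F.

(* Trees labelled in {0, 1}, with [true] for the letter 1. *)
Definition lang_L : set (trees bool) :=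
  [set t | exists2 u, is_branch u &
     forall N, exists2 i, (N <= i)%N & t (u i) = true].

(* The node l^a_(n-1) r l^a_(n-2) r ... l^a_0 r for a = [:: a_(n-1); ...; a_0] *)
Definition node (a : seq nat) : seq bool :=
  flatten [seq nseq k lft ++ [:: rgt] | k <- a].

Definition lang_L1 : set (trees bool) :=
  [set t | exists m, [/\ lang_L (subtree t (node [:: m])),
     forall k, (k < m)%N -> ~ lang_L (subtree t (node [:: k])) & odd m]].

Definition lang_Lge2 (n : nat) : set (trees bool) :=
  [set t | exists a : n.-tuple nat,
     [/\ lang_L (subtree t (node a)), odd_ord (Ord a)
       & forall b : n.-tuple nat, wlt (Ord b) (Ord a) ->
           ~ lang_L (subtree t (node b))]].

(* Meaningful for n >= 1. *)
Definition lang_Ln (n : nat) : set (trees bool) :=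
  if n == 1 then lang_L1 else lang_Lge2 n.

(* A Mostowski-Rabin index (iota, kappa) is a pair satisfying is_index. *)
Definition is_index (i : nat * nat) := (i.1 <= 1)%N && (i.1 <= i.2)%N.

Definition index_le (i j : nat * nat) :=
  ((j.1 <= i.1)%N && (i.2 <= j.2)%N) ||
  [&& i.1 == 0, j.1 == 1 & (i.2 + 2 <= j.2)%N].

Definition dual_index (i : nat * nat) : nat * nat :=
  if i.1 == 0 then (1, i.2.+1) else (0, i.2.-1).

Lemma dual_index_02 : dual_index (0, 2) = (1, 3). Proof. by []. Qed.

(* The alphabet {exists, forall} * {iota, ..., kappa}, with [true] for exists. *)
Definition game_alphabet (i : nat * nat) : finType :=
  (bool * {k : 'I_i.2.+1 | (i.1 <= k)%N})%type.

Definition eve_node (i : nat * nat) (a : game_alphabet i) : bool := a.1.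
Definition priority (i : nat * nat) (a : game_alphabet i) : nat := val (val a.2).

(* A bounded sequence of integers has limsup m iff it takes the value m
   infinitely often and larger values only finitely often. *)
Definition is_limsup (c : nat -> nat) (m : nat) :=
  (forall N, exists2 k, (N <= k)%N & c k = m) /\
  (exists N, forall k, (N <= k)%N -> (c k <= m)%N).

(* A position determines the play leading to it, so a strategy for Eve maps
   positions to directions; it is used only at the positions where she moves. *)
Definition consistent (i : nat * nat) (t : trees (game_alphabet i))
    (sigma : seq bool -> bool) (v : nat -> seq bool) :=
  forall k, eve_node (t (v k)) -> v k.+1 = rcons (v k) (sigma (v k)).

Definition eve_wins_play (i : nat * nat) (t : trees (game_alphabet i))
    (v : nat -> seq bool) :=
  exists2 m, is_limsup (fun k => priority (t (v k))) m & ~~ odd m.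

Definition lang_W (i : nat * nat) : set (trees (game_alphabet i)) :=
  [set t | exists sigma : seq bool -> bool, forall v, is_branch v ->
     consistent t sigma v -> eve_wins_play t v].
Arguments lang_W : clear implicits.

(* Main.v *)
From HB Require Import structures.
Require Import Defs.
From mathcomp Require Import all_boot all_order all_algebra.
From mathcomp Require Import all_classical all_analysis.

(* Every D_eta set with eta < omega^omega, as well as its complement, is a
   countable union of sets P_k \ N_k with P_k and N_k analytic. Such a union
   reduces to W_(0,2) and to W_(1,3): Eve picks k, then Adam either asks her to
   prove membership in P_k or proves membership in N_k himself, both by
   exhibiting a branch with infinitely many 1s. Applied to L_n, this is the
   Wadge reduction.
   The reductions from analytic sets are moreover delayed: the label at depth d
   of the output depends only on the input at depth less than d, so that they
   have fixed points. If W_(iota,kappa) were in D_alpha, its complement would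
   reduce to it by a delayed map, and a fixed point of this map would belong to
   both or to neither. *)

Set Implicit Arguments.
Unset Strict Implicit.
Unset Printing Implicit Defensive.

Local Open Scope classical_set_scope.

(** * Cantor spaces and delayed maps *)

Lemma cvg_cantorP (I : Type) (S : choiceType) (T : Type) (F : set_system T)
    (FF : Filter F) (f : T -> cantor_pow I S) (x : cantor_pow I S) :
  f @ F --> x <-> forall i, \forall z \near F, f z i = x i.
Proof.
apply: iff_trans (cvg_sup _ x (fmap_filter f FF)) _.
split=> fx i.
  apply: (fx i [set x' | x' i = x i]).
  exists [set x' | x' i = x i]; split=> //.
  by exists [set x i] => //; exact: discrete_open.
move=> A [B [[C _ <-] Cx BA]].
by have := fx i; apply: filterS => z fz; apply: BA; rewrite /preimage/= fz.
Qed.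

Lemma near_cantor (I : Type) (S : choiceType) (x : cantor_pow I S) (i : I) :
  \forall z \near x, z i = x i.
Proof.
exact: (@cvg_cantorP I S _ (nbhs x) (nbhs_filter x) (fun z => z) x).1.
Qed.

Lemma continuous_cantorP (X : topologicalType) (I : Type) (S : choiceType)
    (f : X -> cantor_pow I S) :
  continuous f <-> forall x i, \forall z \near x, f z i = f x i.
Proof. by split=> H x; have /cvg_cantorP := H x. Qed.

(** Only finitely many indices have rank below [n], so agreement on all of them is an open
    condition. *)
Definition finite_rank (I : Type) (rk : I -> nat) :=
  forall n, exists (J : finType) (g : J -> I),
    forall i, (rk i < n)%N -> exists j, g j = i.

Lemma finite_rank_nat : finite_rank id.
Proof. by move=> n; exists 'I_n, val => i ltin; exists (Ordinal ltin). Qed.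

Lemma finite_rank_size (T : finType) : finite_rank (@size T).
Proof.
move=> n; exists (n.-bseq T), val => s sn.
by exists (Bseq (ltnW sn)).
Qed.

Lemma near_agree (I : Type) (S : choiceType) (rk : I -> nat)
    (x : cantor_pow I S) n : finite_rank rk ->
  \forall z \near x, forall i, (rk i < n)%N -> z i = x i.
Proof.
move=> /(_ n)[J [g gP]].
have : \forall z \near x, forall j, z (g j) = x (g j).
  apply: (@filter_forall _ J (fun j z => z (g j) = x (g j)) _ (nbhs_filter x)).
  by move=> j; exact: near_cantor.
by apply: filterS => z zx i /gP[j <-].
Qed.

(** [rk] is the depth of an input coordinate: [id] for words, [size] for trees. *)
Definition delayed (I : Type) (rk : I -> nat) (S S' : choiceType)
    (F : cantor_pow I S -> trees S') :=
  forall x x' w, (forall i, (rk i < size w)%N -> x i = x' i) -> F x w = F x' w.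

Lemma delayed_continuous (I : Type) (rk : I -> nat) (S S' : choiceType)
    (F : cantor_pow I S -> trees S') :
  finite_rank rk -> delayed rk F -> continuous F.
Proof.
move=> rkf Fd; apply/continuous_cantorP => x w.
by have := near_agree x (size w) rkf; apply: filterS => z zx; exact: Fd.
Qed.

(** Under iteration of [F] from [t0], the labels at depth d are settled after d + 1 steps; the
    settled labels form the fixed point. *)
Lemma delayed_fixpoint (S : choiceType) (F : trees S -> trees S) (t0 : trees S) :
  delayed size F -> exists t, F t = t.
Proof.
move=> Fd; pose t_ k := iter k F t0.
have step k w : (size w < k)%N -> t_ k.+1 w = t_ k w.
  elim: k w => // k IH w wk; apply: Fd => v vw; apply: IH.
  exact: leq_trans vw wk.
have stab k m w : (size w < k)%N -> t_ (k + m) w = t_ k w.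
  move=> wk; elim: m => [|m <-]; rewrite ?addn0// addnS step//.
  exact: leq_trans wk (leq_addr _ _).
exists (fun w => t_ (size w).+1 w); apply/funext => w.
rewrite -(@step _ w)//; apply: (Fd _ (t_ (size w).+1)) => v vw.
have [m ->] : exists m, size w = (size v + m)%N.
  by exists (size w - size v)%N; rewrite subnKC// ltnW.
by rewrite -addSn stab.
Qed.

(** * Analytic sets *)

Section Analytic.
Variable X : topologicalType.

Lemma analytic0 : @analytic X set0.
Proof. by exists set0; [exact: closed0|rewrite image_set0]. Qed.

Lemma analyticT : @analytic X setT.
Proof.
exists setT; first exact: closedT.
by apply/seteqP; split=> // x _; exists (x, fun=> 0).
Qed.

Lemma analytic_preimage (Y : topologicalType) (f : X -> Y) (A : set Y) :
  continuous f -> analytic A -> analytic (f @^-1` A).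
Proof.
move=> fc [C clC ->]; exists ((fun p => (f p.1, p.2)) @^-1` C).
  apply: preimage_closed clC => -[x y] _.
  apply: (@cvg_pair _ _ _ _ (nbhs (f x)) (nbhs y)); last exact: cvg_snd.
  exact: (@cvg_comp _ _ _ fst f (nbhs (x, y)) (nbhs x) (nbhs (f x)) cvg_fst (fc x)).
apply/seteqP; split=> [x [[x' y] Cxy /= x'E]|x [[x' y] Cxy <-]].
  by exists (x, y) => //=; rewrite -x'E.
by exists (f x', y).
Qed.

Lemma near_cantor_snd (I : Type) (S : choiceType) (p : X * cantor_pow I S) i :
  \forall q \near p, q.2 i = p.2 i.
Proof. exact: (@cvg_snd _ _ (nbhs p.1) (nbhs p.2) _ _ (near_cantor p.2 i)). Qed.

Lemma analytic_bigcup (A : nat -> set X) :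
  (forall k, analytic (A k)) -> analytic (\bigcup_k A k).
Proof.
move=> /(_ _)/cid2-/all_sig2[C clC AE].
pose tl (p : X * omega_words nat) : X * omega_words nat :=
  (p.1, fun j => p.2 j.+1).
(* The first entry of the witness names the index k and its tail is a witness for [A k]. Writing
   this as an intersection over all k makes it visibly closed. *)
exists (\bigcap_k ([set p : X * omega_words nat | p.2 0 <> k] `|` tl @^-1` C k)).
  apply: closed_bigI => k _; apply: closedU.
    rewrite -openC openE => p /= /contrapT pk.
    by have := near_cantor_snd p 0; rewrite pk; apply: filterS => q /= ->.
  apply: preimage_closed (clC k) => p _.
  apply: (@cvg_pair _ _ _ _ (nbhs p.1) (nbhs (tl p).2)); first exact: cvg_fst.
  by apply/cvg_cantorP => j; exact: near_cantor_snd.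
apply/seteqP; split=> [x [k _]|x [p Cp <-]].
  rewrite AE => -[[x' y] Cxy /= <-].
  exists (x', fun j => if j is j'.+1 then y j' else k) => //= k' _ /=.
  by case: (eqVneq k k') => [<-|/eqP]; [right|left].
exists (p.2 0) => //; rewrite AE; exists (tl p) => //.
by have [] := Cp (p.2 0) I.
Qed.

Lemma analytic_bigcup_count (T : countType) (A : T -> set X) :
  (forall k, analytic (A k)) -> analytic (\bigcup_k A k).
Proof.
move=> An.
rewrite (_ : \bigcup_k A k = \bigcup_n (if unpickle n is Some k then A k else set0)).
  by apply: analytic_bigcup => n; case: unpickle => //; exact: analytic0.
apply/seteqP; split=> x; last by move=> [n _]; case: unpickle => // k; exists k.
by move=> [k _ Akx]; exists (pickle k) => //; rewrite pickleK.
Qed.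

End Analytic.

(** * Branches and nodes *)

Section Branches.
Implicit Types (u : nat -> seq bool) (d : nat -> bool).

Lemma mkseq_cat (T : Type) (f : nat -> T) m n :
  mkseq f (m + n) = mkseq f m ++ mkseq (fun j => f (m + j)%N) n.
Proof.
elim: n => [|n IH]; first by rewrite addn0 cats0.
by rewrite addnS !mkseqS IH rcons_cat.
Qed.

Lemma is_branch_mkseq d : is_branch (mkseq d).
Proof. by split=> // j; rewrite mkseqS; case: (d j); [right|left]. Qed.

Lemma is_branchP u : is_branch u <-> exists d, u = mkseq d.
Proof.
split=> [[u0 uS]|[d ->]]; last exact: is_branch_mkseq.
exists (fun j => last false (u j.+1)); apply/funext; elim=> [|j IH] //.
by rewrite mkseqS -IH; case: (uS j) => ->; rewrite last_rcons.
Qed.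

Definition infinitely_often (b : nat -> bool) :=
  forall N, exists2 j, (N <= j)%N & b j = true.

Lemma lang_LP t : lang_L t <-> exists d, infinitely_often (fun j => t (mkseq d j)).
Proof.
split=> [[u /is_branchP[d ->] dt]|[d dt]]; first by exists d.
by exists (mkseq d) => //; exact: is_branch_mkseq.
Qed.

Lemma branch_following (s : seq bool -> bool) :
  exists d, forall j, d j = s (mkseq d j).
Proof.
pose pos n := iter n (fun v => rcons v (s v)) [::].
exists (fun j => s (pos j)) => j; congr s.
by elim: j => // j IH; rewrite mkseqS -IH.
Qed.

End Branches.

Section Nodes.
Implicit Types (a b : seq nat) (w : seq bool).

Lemma node_cons k a : node (k :: a) = nseq k lft ++ rgt :: node a.
Proof. by rewrite /node/= -catA. Qed.

Lemma node_cat a b : node (a ++ b) = node a ++ node b.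
Proof. by rewrite /node map_cat flatten_cat. Qed.

Lemma last_node x a k : last x (node (rcons a k)) = true.
Proof. by rewrite -cats1 node_cat node_cons !last_cat. Qed.

Lemma size_node a : (size a <= size (node a))%N.
Proof.
elim: a => // k a IH; rewrite node_cons size_cat/= addnS ltnS.
exact: leq_trans IH (leq_addl _ _).
Qed.

(** A left inverse of [node]: it lists the lengths of the blocks of [lft] closed by a [rgt], where
    [k] counts the current block. An unclosed last block is dropped. *)
Fixpoint runs k w : seq nat :=
  if w is c :: w' then if c then k :: runs 0 w' else runs k.+1 w' else [::].

Lemma runs_nseq k m w : runs k (nseq m lft ++ rgt :: w) = (k + m)%N :: runs 0 w.
Proof. by elim: m k => [|m IH] k /=; rewrite ?addn0// IH addSnnS. Qed.

Lemma runs_node a w : runs 0 (node a ++ w) = a ++ runs 0 w.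
Proof. by elim: a => // k a IH; rewrite node_cons -catA cat_cons runs_nseq/= IH. Qed.

Lemma size_runs k w : size (runs k w) = count id w.
Proof. by elim: w k => // -[] w IH k /=; rewrite IH. Qed.

Lemma nth_runs_cat k w w' m : (m < size (runs k w))%N ->
  nth 0 (runs k (w ++ w')) m = nth 0 (runs k w) m.
Proof. by elim: w k m => //= -[] w IH k [|m] //= mw; rewrite IH. Qed.

Lemma node_cat_inj a b w w' :
  size a = size b -> node a ++ w = node b ++ w' -> a = b /\ w = w'.
Proof.
move=> ab nab; have abE : a = b.
  have := congr1 (runs 0) nab; rewrite !runs_node => /eqP.
  by rewrite eqseq_cat// => /andP[/eqP].
by split=> //; move/eqP: nab; rewrite abE eqseq_cat// eqxx => /eqP.
Qed.

Lemma branch_through_nodes (y : nat -> nat) :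
  exists d, forall j, mkseq d (size (node (mkseq y j))) = node (mkseq y j).
Proof.
have pre j m i : (i < size (node (mkseq y j)))%N ->
    nth false (node (mkseq y (j + m))) i = nth false (node (mkseq y j)) i.
  by move=> ij; rewrite mkseq_cat node_cat nth_cat ij.
(* The nodes of the prefixes of [y] extend one another, and that of the prefix of length i + 1 is
   long enough to contain direction i. *)
exists (fun i => nth false (node (mkseq y i.+1)) i) => j.
apply: (@eq_from_nth _ false) => [|i]; rewrite size_mkseq// => ij.
rewrite nth_mkseq//; case: (leqP i.+1 j) => [/subnKC <-|/ltnW/subnKC <-].
  by rewrite pre// (leq_trans _ (size_node _))// size_mkseq.
by rewrite pre.
Qed.

End Nodes.

(** * Reductions to L *)

Lemma analytic_lang_L : analytic lang_L.
Proof.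
(* [y j] packs the [j]-th direction of the branch and a later occurrence of 1. *)
pose dir (y : omega_words nat) j := odd (y j).
pose C N : set (trees bool * omega_words nat) :=
  [set p | (N <= (p.2 N)./2)%N /\ p.1 (mkseq (dir p.2) (p.2 N)./2) = true].
exists (\bigcap_N C N).
  apply: closed_bigI => N _; rewrite -openC openE => p Cp.
  (* Membership in [C N] depends on one label of the tree, on entry [N] of the witness and on
     finitely many parities, so its failure is an open condition. *)
  have p2 := near_agree p.2 (maxn N.+1 (p.2 N)./2) finite_rank_nat.
  have p1 := near_cantor p.1 (mkseq (dir p.2) (p.2 N)./2).
  have {}p1 := @cvg_fst _ _ _ _ (nbhs_filter p.2) _ p1.
  have {}p2 := @cvg_snd _ _ _ _ (nbhs_filter p.1) _ p2.
  have := @filterI _ _ (nbhs_filter p) _ _ p1 p2.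
  apply: filterS => q [/= q1 q2] [Nq tq]; apply: Cp.
  have qN : q.2 N = p.2 N by apply: q2; rewrite leq_max leqnn.
  rewrite /C/= -q1 -qN; split=> //; rewrite -tq; congr (q.1 _).
  apply/eq_in_map => j; rewrite mem_iota/= add0n => jN.
  by rewrite /dir q2// leq_max -qN jN orbT.
apply/seteqP; split=> [t /lang_LP[d]|_ [p Cp <-]].
  move=> /(_ _)/cid2-/all_sig2[k kN tk].
  exists (t, fun j => (d j + (k j).*2)%N) => // N _; rewrite /C/= half_bit_double.
  split=> //; rewrite -[RHS](tk N); congr t; apply: eq_map => j.
  by rewrite /dir oddD odd_double addbF oddb.
by apply/lang_LP; exists (dir p.2) => N; have [] := Cp N I; exists (p.2 N)./2.
Qed.

(** Sequences in the Baire space are coded by branches through the [node] of their prefixes. A node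
    gets label 1 when it codes a nonempty prefix of a witness [y] for some [x'] agreeing with [x]
    below the depth of the node. Infinitely many 1s on a branch thus yield points of [C] converging
    to a pair with first component [x], which is in [C] by closedness. *)
Lemma analytic_reduction (I : Type) (rk : I -> nat) (S : choiceType)
    (A : set (cantor_pow I S)) : analytic A ->
  exists2 f : cantor_pow I S -> trees bool, delayed rk f & A = f @^-1` lang_L.
Proof.
move=> [C clC ->].
pose Q (x : cantor_pow I S) w (x' : cantor_pow I S) (y : omega_words nat) j :=
  [/\ C (x', y), forall i, (rk i < size w)%N -> x' i = x i
    & w = node (mkseq y j.+1)].
pose f x w := `[< exists x' y j, Q x w x' y j >].
exists (f : cantor_pow I S -> trees bool).
  move=> x z w xz; congr asbool; apply/propext.
  split=> -[x' [y [j [Cxy xx' wE]]]]; exists x', y, j; split=> // i iw.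
    by rewrite xx'// xz.
  by rewrite xx'// xz.
apply/seteqP; split=> [_ [[x y] Cxy <-]|x /lang_LP[d dx]].
  have [d dP] := branch_through_nodes y.
  apply/lang_LP; exists d => N; exists (size (node (mkseq y N.+1))).
    by rewrite (leq_trans _ (size_node _))// size_mkseq.
  by rewrite dP; apply/asboolP; exists x, y, N.
have sizej i x' y j : Q x (mkseq d i) x' y j -> count id (mkseq d i) = j.+1.
  by case=> _ _ ->; rewrite -[node _]cats0 -(size_runs 0) runs_node cats0 size_mkseq.
(* Each further 1 on the branch sits just after a right turn, so the coded prefixes grow without
   bound. *)
have : forall M, exists x' y i j,
    [/\ Q x (mkseq d i) x' y j, (M <= i)%N & (M <= j)%N].
  elim=> [|M [_ [_ [i [j [/sizej ij Mi Mj]]]]]].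
    by have [i _ /asboolP[x' [y [j Qj]]]] := dx 0; exists x', y, i, j.
  have [[//|i'] ii' /asboolP[x' [y [j' Qj]]]] := dx (maxn i M).+1.
  move: ii'; rewrite ltnS geq_max => /andP[ii' Mi'].
  exists x', y, i'.+1, j'; split=> //; rewrite -ltnS -(sizej _ _ _ _ Qj).
  case: Qj => _ _; rewrite !mkseqS => /(congr1 (last false)).
  rewrite last_rcons last_node => ->.
  rewrite -cats1 count_cat/= addn1 ltnS -(subnKC ii') mkseq_cat count_cat ij.
  by rewrite (leq_trans _ (leq_addr _ _)).
move=> /(_ _)/cid-/all_sig[xM]/(_ _)/cid-/all_sig[yM].
move=> /(_ _)/cid-/all_sig[iM]/(_ _)/cid-/all_sig[jM QM].
(* All the approximating witnesses code prefixes along the same branch, so their entries are read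
   off [d] by [runs] and agree. The diagonal is their limit. *)
pose y : omega_words nat := fun m => yM m.+1 m.
have nthM M m : (m < M)%N ->
    yM M m = nth 0 (runs 0 (mkseq d (iM M))) m /\
    (m < size (runs 0 (mkseq d (iM M))))%N.
  move=> mM; have [[_ _ ->] _ Mj] := QM M.
  rewrite -[node _]cats0 runs_node cats0 size_mkseq ltnS.
  have mj : (m <= jM M)%N by exact: leq_trans (ltnW mM) Mj.
  by rewrite nth_mkseq.
have yE M m : (m < M)%N -> yM M m = y m.
  move=> mM; have [-> sM] := nthM _ _ mM; rewrite /y.
  have [-> sm] := nthM _ _ (ltnSn m).
  have /orP[/subnKC E|/subnKC E] := leq_total (iM M) (iM m.+1); move: sM sm.
    by rewrite -E mkseq_cat => sM _; rewrite nth_runs_cat.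
  by rewrite -E mkseq_cat => _ sm; rewrite nth_runs_cat.
exists (x, y) => //.
apply: (@closed_cvg _ _ \oo _ (fun M => (xM M, yM M)) _ clC).
  by apply: nearW => M; have [[]] := QM M.
apply: (@cvg_pair _ _ _ _ (nbhs x) (nbhs y)); apply/cvg_cantorP => i.
  exists (rk i).+1 => // M /= iM'; have [[_ xx' _] Mi _] := QM M.
  by apply: xx'; rewrite size_mkseq (leq_trans iM').
by exists i.+1 => // M /= iM'; exact: yE.
Qed.

(** * The game *)

Section Limsup.
Implicit Types (c : nat -> nat) (b : nat -> bool).

Lemma is_limsup_unique c m m' : is_limsup c m -> is_limsup c m' -> m = m'.
Proof.
move=> [im [N bm]] [im' [N' bm']]; apply/eqP; rewrite eqn_leq.
have [k /bm' km' kE] := im N'; have [k' /bm k'm k'E] := im' N.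
by rewrite -{1}kE -{2}k'E km'.
Qed.

Lemma is_limsup_high c b p m : (forall j, c (p + j)%N = (m + b j)%N) ->
  infinitely_often b -> is_limsup c m.+1.
Proof.
move=> cE bi; split=> [N|].
  have [j Nj bj] := bi N; exists (p + j)%N; last by rewrite cE bj addn1.
  by rewrite (leq_trans Nj)// leq_addl.
exists p => k /subnKC <-; rewrite cE -addn1 leq_add2l.
exact: leq_b1.
Qed.

Lemma is_limsup_low c b p m : (forall j, c (p + j)%N = (m + b j)%N) ->
  ~ infinitely_often b -> is_limsup c m.
Proof.
move=> cE /existsNP[N bN].
have b0 j : (N <= j)%N -> b j = false.
  by move=> Nj; apply/negbTE/negP => bj; apply: bN; exists j.
have cN j : (p + N <= j)%N -> c j = m.
  move=> pNj; rewrite -(subnKC pNj) -addnA cE b0 ?addn0//.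
  exact: leq_addr.
split=> [M|]; last by exists (p + N)%N => k /cN ->.
by exists (maxn (p + N) M); rewrite ?cN// leq_max leqnn ?orbT.
Qed.

End Limsup.

Section Game.
Variables (e : nat) (P N : nat -> trees bool).

(* Eve first chooses k by going to l^k r. Adam then either goes left and lets
   Eve exhibit a branch of P k with infinitely many 1s (priorities 1, 2), or goes
   right and exhibits one of N k himself (priorities e, e + 1, with e even).
   Staying forever on the spine l^omega has priority 1 and is lost for Eve. *)
Fixpoint game_label k (v : seq bool) : bool * nat :=
  match v with
  | [::] => (true, 1)
  | false :: v' => game_label k.+1 v'
  | [:: true] => (false, 1)
  | true :: false :: w => (true, 1 + P k w)
  | true :: true :: w => (false, e + N k w)
  end.

Lemma game_label_spine k m : game_label k (nseq m lft) = (true, 1).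
Proof. by elim: m k => //= m IH k; rewrite IH. Qed.

Lemma game_label_node k m w :
  game_label k (nseq m lft ++ rgt :: w) =
    match w with
    | [::] => (false, 1)
    | false :: w' => (true, 1 + P (k + m) w')%N
    | true :: w' => (false, e + N (k + m) w')%N
    end.
Proof.
elim: m k => [|m IH] k; first by rewrite addn0; case: w => // -[].
by rewrite [LHS]/= IH addSnnS.
Qed.

Lemma game_label_range m n k v : (m <= 1)%N -> (m <= e)%N -> (1 < n)%N ->
  (e < n)%N -> (m <= (game_label k v).2 <= n)%N.
Proof.
move=> m1 me n1 en; elim: v k => [|[] v IH] k //=; first by rewrite m1 ltnW.
case: v {IH} => [|[] w] /=; first by rewrite m1 ltnW.
  by rewrite (leq_trans me) ?leq_addr//; case: (N k w); rewrite ?addn1// addn0 ltnW.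
by rewrite (leq_trans m1)//; case: (P k w) => //; rewrite ltnW.
Qed.

Definition leaves_at k (d : nat -> bool) :=
  (forall j, (j < k)%N -> d j = lft) /\ d k = rgt.

Lemma mkseq_lft k (d : nat -> bool) : (forall j, (j < k)%N -> d j = lft) ->
  mkseq d k = nseq k lft.
Proof.
move=> dk; apply: (@eq_from_nth _ lft); rewrite size_mkseq ?size_nseq// => j jk.
by rewrite nth_mkseq// nth_nseq jk dk.
Qed.

Section LeavesAt.
Variables (k : nat) (d : nat -> bool).
Hypothesis dk : leaves_at k d.

(** The offset skips the [k] moves along the spine, the right turn and Adam's choice. *)
Let rest j := d (k.+2 + j)%N.

Lemma game_label_adam : game_label 0 (mkseq d k.+1) = (false, 1).
Proof.
rewrite mkseqS mkseq_lft; last exact: dk.1.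
by rewrite dk.2 -cats1 game_label_node.
Qed.

Lemma game_label_after j : game_label 0 (mkseq d (k.+2 + j)) =
  if d k.+1 then (false, e + N k (mkseq rest j))%N
  else (true, 1 + P k (mkseq rest j))%N.
Proof.
rewrite mkseq_cat 2!mkseqS mkseq_lft; last exact: dk.1.
by rewrite dk.2 -!cats1 -!catA game_label_node add0n/=; case: (d k.+1).
Qed.

End LeavesAt.

Lemma lang_W_game (i : nat * nat) (t : trees (game_alphabet i)) :
  ~~ odd e ->
  (forall v, eve_node (t v) = (game_label 0 v).1 /\
             priority (t v) = (game_label 0 v).2) ->
  lang_W i t <-> exists k, lang_L (P k) /\ ~ lang_L (N k).
Proof.
move=> e_even tE; split=> [[s sW]|[k [/lang_LP[u Pu] Nk]]].
  have win d : (forall j, (game_label 0 (mkseq d j)).1 -> d j = s (mkseq d j)) ->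
      forall m, is_limsup (fun j => (game_label 0 (mkseq d j)).2) m -> ~~ odd m.
    move=> ds m dm; have [|m' dm' m'e] := sW _ (is_branch_mkseq d).
      by move=> j; rewrite (tE _).1 => /ds <-; rewrite mkseqS.
    suff -> : m = m' by [].
    apply: is_limsup_unique dm _; move: dm'; congr is_limsup.
    by apply/funext => j; rewrite (tE _).2.
  (* The play [d0] must leave the spine, since staying there gives limsup 1. All spine positions
     belong to Eve, so [s] alone fixes the place [k] where she leaves it. *)
  have [d0 d0s] := branch_following s.
  have ex_k : exists k, d0 k.
    apply: contrapT => /forallNP d0N.
    have := @win d0 (fun j _ => d0s j) 1; suff h : is_limsup
      (fun j => (game_label 0 (mkseq d0 j)).2) 1 by move=> /(_ h).
    apply: (@is_limsup_low _ (fun=> false) 0); last by move=> /(_ 0)[].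
    move=> j; rewrite add0n mkseq_lft ?game_label_spine// => i' _.
    exact/negbTE/negP.
  pose k := ex_minn ex_k; exists k.
  have [s_lft s_rgt] : (forall j, (j < k)%N -> s (nseq j lft) = lft) /\
      s (nseq k lft) = rgt.
    rewrite /k; case: ex_minnP => {}k d0k kmin.
    have d0l j : (j < k)%N -> d0 j = lft.
      by move=> jk; apply/negbTE/negP => /kmin; rewrite leqNgt jk.
    split=> [j jk|]; last by rewrite -(mkseq_lft d0l) -d0s.
    rewrite -(@mkseq_lft _ d0); first by rewrite -d0s d0l.
    by move=> j' j'j; rewrite d0l// (ltn_trans j'j).
  have leaves d : (forall j, (j <= k)%N -> d j = s (mkseq d j)) -> leaves_at k d.
    move=> ds; have dl j : (j < k)%N -> d j = lft.
      elim/ltn_ind: j => j IH jk; rewrite ds ?(ltnW jk)// mkseq_lft ?s_lft//.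
      by move=> j' j'j; rewrite IH// (ltn_trans j'j).
    by split=> //; rewrite ds// mkseq_lft.
  split.
    (* Adam answers left at depth [k.+1]. All later positions are Eve's, and her strategy must
       produce infinitely many 1s in [P k]. *)
    have [d ds] := branch_following
      (fun v => if size v == k.+1 then lft else s v).
    have {}ds j : d j = if j == k.+1 then lft else s (mkseq d j).
      by rewrite ds size_mkseq.
    have dk : leaves_at k d.
      by apply: leaves => j jk; rewrite ds ltn_eqF// ltnS.
    have dk1 : d k.+1 = lft by rewrite ds eqxx.
    apply: contrapT => PN; have : ~~ odd 1; last by [].
    apply: (win d) => [j|].
      by rewrite ds; case: eqP => // ->; rewrite game_label_adam.
    apply: (@is_limsup_low _ _ k.+2) => [j|]; first by rewrite game_label_after// dk1.
    by move=> H; apply: PN; apply/lang_LP; eexists; exact: H.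
  move=> /lang_LP[u Nu].
  (* Adam answers right and then follows [u]. As all later positions are his, the play is consistent
     with [s], yet its limsup is the odd number [e.+1]. *)
  pose d j := if (j < k.+2)%N then j >= k else u (j - k.+2).
  have dk : leaves_at k d.
    split=> [j jk|]; first by rewrite /d (leq_trans jk)// 1?leqW// leqNgt jk.
    by rewrite /d ltnS leqnSn leqnn.
  have dk1 : d k.+1 = rgt by rewrite /d leqnn leqnSn.
  have : ~~ odd e.+1; last by rewrite /= e_even.
  apply: (win d) => [j|].
    have [jk _|] := leqP j k.
      rewrite mkseq_lft; last by move=> j' /leq_trans/(_ jk); exact: dk.1.
      by move: jk; rewrite leq_eqVlt => /orP[/eqP->|jk]; rewrite ?dk.2// dk.1// s_lft.
    rewrite leq_eqVlt => /orP[/eqP <-|/subnKC <-]; first by rewrite game_label_adam.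
    by rewrite game_label_after// dk1.
  apply: (@is_limsup_high _ _ k.+2) => [j|]; first by rewrite game_label_after// dk1.
  move=> M; have [j Mj Nj] := Nu M; exists j => //; rewrite -Nj; congr (N k _).
  by apply: eq_map => j'; rewrite /d ltnNge leq_addr/= addKn.
(* Eve's moves depend on the depth only: to l^k r, then along [u]. At depth [k.+1] Adam moves, and
   the value there is a default. *)
pose D j := if (j < k)%N then lft else if j == k then rgt else
  if j == k.+1 then lft else u (j - k.+2).
exists (D \o size) => v /is_branchP[d ->] ds.
have {}ds j : (game_label 0 (mkseq d j)).1 -> d j = D j.
  have := ds j; rewrite (tE _).1 mkseqS/= size_mkseq => H /H.
  by move=> /rcons_inj[].
have dl j : (j < k)%N -> d j = lft.
  elim/ltn_ind: j => j IH jk; rewrite ds; first by rewrite /D jk.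
  rewrite mkseq_lft ?game_label_spine// => j' j'j.
  by rewrite IH// (ltn_trans j'j).
have dk : leaves_at k d.
  split=> //; rewrite ds; first by rewrite /D ltnn eqxx.
  by rewrite mkseq_lft// game_label_spine.
have prioE m : is_limsup (fun j => (game_label 0 (mkseq d j)).2) m ->
    is_limsup (fun j => priority (t (mkseq d j))) m.
  by congr is_limsup; apply/funext => j; rewrite (tE _).2.
case dk1 : (d k.+1).
  exists e => //; apply: prioE.
  apply: (@is_limsup_low _ _ k.+2) => [j|]; first by rewrite game_label_after// dk1.
  by move=> H; apply: Nk; apply/lang_LP; eexists; exact: H.
exists 2 => //; apply: prioE.
apply: (@is_limsup_high _ _ k.+2) => [j|]; first by rewrite game_label_after// dk1.
move=> M; have [j Mj uj] := Pu M; exists j => //; rewrite -uj; congr (P k _).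
apply: eq_map => j'; rewrite ds; last by rewrite game_label_after// dk1.
by rewrite /D ltnNge !gtn_eqF ?addKn// !(leq_trans _ (leq_addr _ _))// leqW.
Qed.

End Game.

Lemma game_letter (i : nat * nat) : is_index i ->
  exists letter : bool * nat -> game_alphabet i, forall b k,
    (i.1 <= k <= i.2)%N ->
    eve_node (letter (b, k)) = b /\ priority (letter (b, k)) = k.
Proof.
move=> /andP[_ i12].
pose top : {k : 'I_i.2.+1 | (i.1 <= k)%N} := Sub ord_max i12.
exists (fun a => (a.1, insubd top (inord a.2))) => b k /andP[ik ki].
by rewrite /priority val_insubd/= inordK ?ltnS// ik inordK.
Qed.

(* Priorities 0, 1, 2 or 1, 2, 3 are available. *)
Lemma game_index (i : nat * nat) : is_index i ->
    index_le (0, 2) i \/ i = (1, 3) ->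
  exists2 e, ~~ odd e & [/\ i.1 <= 1, i.1 <= e, 1 < i.2 & e < i.2]%N.
Proof.
case: i => i1 i2 /andP[/= i1_le _] [|[-> ->]]; last by exists 2.
move=> /orP[/=/andP[]|/and3P[_ /= /eqP -> i2_ge]].
  by rewrite leqn0 => /eqP -> i2_ge; exists 0 => //; split=> //; exact: ltnW.
by exists 2 => //; split=> //=; rewrite (leq_trans _ i2_ge).
Qed.

Lemma analytic_and (X : topologicalType) (Q : Prop) (A : set X) :
  (Q -> analytic A) -> analytic [set x | Q /\ A x].
Proof.
move=> An; have [q|nq] := pselect Q.
  rewrite (_ : mkset _ = A); first exact: An.
  by apply/seteqP; split=> x //= [].
rewrite (_ : mkset _ = set0); first exact: analytic0.
by apply/seteqP; split=> x //= [].
Qed.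

Lemma difference_reduction (i : nat * nat) (I : Type) (rk : I -> nat)
    (S : choiceType) (K : countType) (D : set K)
    (P N : K -> set (cantor_pow I S)) :
    is_index i -> index_le (0, 2) i \/ i = (1, 3) ->
    (forall k, D k -> analytic (P k)) -> (forall k, D k -> analytic (N k)) ->
  exists2 F : cantor_pow I S -> trees (game_alphabet i), delayed rk F &
    \bigcup_(k in D) (P k `\` N k) = F @^-1` lang_W i.
Proof.
move=> ii ile anP anN.
(* Eve chooses a natural number, read as the code of some k. Numbers that code nothing in [D] get
   the empty set in place of [P], so that choosing them loses. *)
pose at_code (Q : K -> set (cantor_pow I S)) m :=
  [set x | exists k, [/\ unpickle m = Some k, D k & Q k x]].
have at_codeP Q : (forall k, D k -> analytic (Q k)) -> forall m,
    exists2 f : cantor_pow I S -> trees bool, delayed rk f &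
      at_code Q m = f @^-1` lang_L.
  move=> anQ m; apply: analytic_reduction; rewrite /at_code.
  case: unpickle => [k|].
    rewrite (_ : mkset _ = [set x | D k /\ Q k x]); first exact: analytic_and (anQ k).
    apply/seteqP; split=> x /=; first by case=> _ [[<-]].
    by case; exists k.
  rewrite (_ : mkset _ = set0); first exact: analytic0.
  by apply/seteqP; split=> x //= [k []].
have /(_ _)/cid2-/all_sig2[f fd PE] := at_codeP P anP.
have /(_ _)/cid2-/all_sig2[g gd NE] := at_codeP N anN.
have [e e_even [i1 ie i2 ei]] := game_index ii ile.
have [letter letterP] := game_letter ii.
exists (fun x v => letter (game_label e (f^~ x) (g^~ x) 0 v)).
  (* The label at [v] reads the trees [f m x] and [g m x] at a suffix of [v], so delay is
     preserved. *)
  move=> x x' v xx'; congr letter; move: 0 v xx'.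
  suff H v k : (forall j, (rk j < size v)%N -> x j = x' j) ->
      game_label e (f^~ x) (g^~ x) k v = game_label e (f^~ x') (g^~ x') k v.
    by move=> k v; exact: H.
  elim: v k => // -[] v IH k xx' /=.
    by case: v IH xx' => // -[] w _ xx'; rewrite (gd k x x', fd k x x')// => j jw;
      apply: xx'; rewrite (ltn_trans jw)//= leqW.
  by apply: IH => j jv; apply: xx'; rewrite /= leqW.
apply/funext => x; apply/propext; symmetry.
apply: iff_trans (@lang_W_game e (f^~ x) (g^~ x) i _ e_even _) _ => [v|].
  rewrite [game_label _ _ _ _ _]surjective_pairing.
  exact/letterP/game_label_range.
have fgE m : lang_L (f m x) /\ ~ lang_L (g m x) <->
    at_code P m x /\ ~ at_code N m x.
  by rewrite PE NE; exact: iff_refl.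
split=> [[m /fgE[[k [mk Dk Pk]] Nk]]|[k Dk [Pk Nk]]].
  by exists k => //; split=> // Nkx; apply: Nk; exists k.
exists (pickle k); apply/fgE; split; first by exists k; rewrite pickleK.
by move=> [k' []]; rewrite pickleK => -[<-].
Qed.

(** * Well-orders and ordinals *)

(* Makes [{poly nat}] a countType. *)
HB.saturate nat.

Section WellOrder.
Variable W : wellOrder.
Implicit Types (x y z : W) (P : W -> Prop).

Lemma wlt_irr x : ~ wlt x x.
Proof. by elim/(well_founded_ind (@wlt_wf W)): x => x IH xx; exact: (IH x xx xx). Qed.

Lemma wlt_asym x y : wlt x y -> ~ wlt y x.
Proof. by move=> xy /(wlt_trans xy); exact: wlt_irr. Qed.

Lemma wo_least P x : P x -> exists y, P y /\ forall z, wlt z y -> ~ P z.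
Proof.
elim/(well_founded_ind (@wlt_wf W)): x => x IH Px.
have [[y [yx Py]]|H] := pselect (exists y, wlt y x /\ P y); first exact: (IH y yx Py).
by exists x; split=> // z zx Pz; apply: H; exists z.
Qed.

(** A point is outside the difference set when the first [A theta] containing it has the wrong
    parity, or when no [A theta] below [eta] contains it. The index [eta] itself, standing for the
    whole space, covers the latter case. *)
Lemma setC_diff_set (X : topologicalType) (eta : W) (A : W -> set X) :
  ~` diff_set eta A =
  \bigcup_(theta in [set th | wlt th eta \/ th = eta])
    ([set x | theta = eta \/ ~ (odd_ord theta <-> even_ord eta) /\ A theta x] `\`
     \bigcup_(th in [set th | wlt th theta]) A th).
Proof.
apply/seteqP; split=> x /=.
  move=> nEx; have [th [Pth thmin]] : exists th,
      (th = eta \/ wlt th eta /\ A th x) /\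
      forall z, wlt z th -> ~ (z = eta \/ wlt z eta /\ A z x).
    by apply: (@wo_least _ eta); left.
  have nA th' : wlt th' th -> ~ A th' x.
    move=> th'th Ath'; apply: (thmin _ th'th); right; split=> //.
    by case: Pth th'th => [->//|[th_eta _]]; move/wlt_trans; exact.
  exists th; first by case: Pth => [|[]]; [right|left].
  split; last by move=> [th' /= th'th]; exact: nA.
  case: Pth => [|[th_eta Ath]]; first by left.
  by right; split=> // par; apply: nEx; exists th.
move=> [th th_le [Pth Nth]] [th0 [th0_eta par0 Ath0 min0]].
have th_th0 : ~ wlt th0 th by move=> lt; apply: Nth; exists th0.
case: Pth => [thE|[par Ath]]; first by apply: th_th0; rewrite thE.
by case: (wlt_total th th0) => // [/min0//|thE]; apply: par; rewrite thE.
Qed.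

End WellOrder.

Lemma analytic_bigcup_in (X : topologicalType) (K : countType) (D : set K)
    (A : K -> set X) :
  (forall k, D k -> analytic (A k)) -> analytic (\bigcup_(k in D) A k).
Proof.
move=> An; rewrite bigcup_mkcond; apply: analytic_bigcup_count => k.
by case: ifPn => [/set_mem/An//|_]; exact: analytic0.
Qed.

Lemma not_D_Sigma11_lang_W (i : nat * nat) (alpha : omega_omega) :
  is_index i -> index_le (0, 2) i \/ i = (1, 3) -> ~ D_Sigma11 alpha (lang_W i).
Proof.
move=> ii ile [A [An _ WE]].
have [letter _] := game_letter ii.
pose D := [set th : omega_omega | wlt th alpha \/ th = alpha].
pose P (th : omega_omega) :=
  [set x | th = alpha \/ ~ (odd_ord th <-> even_ord alpha) /\ A th x].
pose N (th : omega_omega) :=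
  \bigcup_(th' in [set th' : omega_omega | wlt th' th]) A th'.
have anP (th : omega_omega) : D th -> analytic (P th).
  rewrite /P => -[th_lt|->].
    rewrite (_ : mkset _ = [set x | ~ (odd_ord th <-> even_ord alpha) /\ A th x]).
      by apply: analytic_and => _; exact: An.
    apply/seteqP; split=> x /=; last by right.
    by case=> // thE; case: (@wlt_irr _ th); rewrite {2}thE.
  rewrite (_ : mkset _ = setT); first exact: analyticT.
  by apply/seteqP; split=> x //= _; left.
have anN (th : omega_omega) : D th -> analytic (N th).
  move=> thD; apply: (@analytic_bigcup_in _ {poly nat}) => th' th'th.
  by apply: An; case: thD th'th => [thlt|->//]; move/wlt_trans; exact.
(* Ordinals below omega^omega are polynomials over [nat], hence countably many, so [F] reduces the
   complement of [lang_W i] to [lang_W i]. *)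
have [F Fd FE] := @difference_reduction i _ size _ {poly nat} D P N ii ile anP anN.
have [t tE] := delayed_fixpoint (fun=> letter (true, 0)) Fd.
have : (~` lang_W i) t <-> lang_W i t.
  by rewrite {1}WE setC_diff_set FE /preimage/= tE.
by rewrite /setC/=; tauto.
Qed.

Section OmegaPow.
Local Open Scope ring_scope.
Import GRing.Theory.

Lemma lt_omega_pow n (p : omega_omega) :
  wlt p (omega_pow n) <-> forall j, (n <= j)%N -> (p : {poly nat})`_j = 0.
Proof.
split=> [[i [+ ij]] j nj|p0].
  rewrite coefXn; case: eqP => // iE; rewrite iE in ij *.
  rewrite ltnS leqn0 => /eqP pn0; move: nj; rewrite leq_eqVlt => /orP[/eqP<-//|nj].
  by rewrite ij// coefXn gtn_eqF.
exists n; rewrite coefXn eqxx p0//; split=> // j nj.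
by rewrite coefXn gtn_eqF// p0// ltnW.
Qed.

Lemma coef_Ord a j : (Ord a : {poly nat})`_j = nth 0%N (rev a) j.
Proof. by rewrite coef_Poly. Qed.

Lemma Ord_lt_omega_pow n (a : n.-tuple nat) : wlt (Ord a) (omega_pow n).
Proof.
apply/lt_omega_pow => j nj.
by rewrite coef_Ord nth_default// size_rev size_tuple.
Qed.

(** Turns quantification over the ordinals below omega^n into quantification over n-tuples. *)
Lemma lt_omega_powP n (p : omega_omega) :
  wlt p (omega_pow n) -> exists a : n.-tuple nat, Ord a = p.
Proof.
move=> /lt_omega_pow p0.
exists (rev_tuple [tuple (p : {poly nat})`_j | j < n]).
apply/polyP => j; rewrite coef_Ord revK.
have [jn|nj] := ltnP j n; last by rewrite p0// nth_default// size_tuple.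
by rewrite -(tnth_nth _ _ (Ordinal jn)) tnth_mktuple.
Qed.

Lemma even_omega_pow n : (0 < n)%N -> even_ord (omega_pow n).
Proof.
move=> n0; exists (omega_pow n), 0%N; split=> // y y_lt.
(* Increasing the constant coefficient gives a larger ordinal, still below omega^n because n is
   positive. *)
exists ((y : {poly nat}) + 1); split.
  exists 0%N; rewrite coefD coef1 eqxx; split; first by rewrite -[(_ + _)%R]/(_ + 1)%N addn1.
  by move=> j j0; rewrite coefD coef1 gtn_eqF// addr0.
apply/lt_omega_pow => j nj; rewrite coefD coef1 gtn_eqF ?addr0; last exact: leq_trans nj.
exact: (lt_omega_pow _ _).1 y_lt j nj.
Qed.

End OmegaPow.

Lemma wlt_Ord1 k m : wlt (Ord [:: k]) (Ord [:: m]) <-> (k < m)%N.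
Proof.
split=> [[j []]|km]; last first.
  exists 0; rewrite !coef_Ord; split=> // j j0.
  by rewrite !coef_Ord !nth_default.
by rewrite !coef_Ord; case: j => // j; rewrite !nth_default.
Qed.

Lemma wlt_Ord1P (p : omega_omega) m :
  wlt p (Ord [:: m]) -> exists2 k, (k < m)%N & p = Ord [:: k].
Proof.
move=> pm; have [a aE] := lt_omega_powP (wlt_trans pm (Ord_lt_omega_pow [tuple m])).
case: a aE => -[|k [|]]//= ak aE.
by exists k => //; apply/wlt_Ord1; rewrite [Ord [:: k]]aE.
Qed.

Lemma is_succ_Ord1 m : is_succ (Ord [:: m]) (Ord [:: m.+1]).
Proof.
split=> [|z mz]; first exact/wlt_Ord1.
have [zm|<-|] := wlt_total z (Ord [:: m.+1]); [|by left|by right].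
have [k km zE] := wlt_Ord1P zm; move: mz; rewrite zE => /wlt_Ord1.
by rewrite ltnNge -ltnS km.
Qed.

Lemma is_succ_unique (W : wellOrder) (x y z : W) :
  is_succ x z -> is_succ y z -> x = y.
Proof.
move=> [xz xS] [yz yS]; have [xy|//|yx] := wlt_total x y.
  by case: (xS _ xy) => [zE|/(wlt_asym yz)//]; case: (@wlt_irr _ y); rewrite -{2}zE.
by case: (yS _ yx) => [zE|/(wlt_asym xz)//]; case: (@wlt_irr _ x); rewrite -{2}zE.
Qed.

Lemma even_Ord1 m : even_ord (Ord [:: m]) <-> ~~ odd m.
Proof.
split=> [[g [k [limg gkm mk]]]|m_even].
  (* A nonzero finite ordinal is a successor, hence not a limit, so the base [g] must be 0 and [k]
     counts the successor steps up to [m]. *)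
  suff -> : m = k by [].
  elim: k m gkm {mk} => [|k IH] m /=.
    case: m => // m mg; have [|z [mz zm]] := limg (Ord [:: m]).
      by rewrite -mg; exact/wlt_Ord1.
    case: (is_succ_Ord1 m) => _ /(_ _ mz).
    by rewrite mg => -[zE|/(wlt_asym zm)//]; case: (@wlt_irr _ z); rewrite -{2}zE.
  move=> [y [gky ym]]; case: m ym => [|m] ym.
    by have [k'] := wlt_Ord1P ym.1.
  by rewrite (IH m)// (is_succ_unique (is_succ_Ord1 m) ym).
exists (Ord [:: 0]), m; split=> //; first by move=> y /wlt_Ord1P[].
elim: m {m_even} => [//|m IH] /=.
by exists (Ord [:: m]); split=> //; exact: is_succ_Ord1.
Qed.

(** Lets the case n = 1 be treated with the general one, the parity of a finite ordinal being that
    of the integer. *)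
Lemma lang_LnE n : (0 < n)%N -> lang_Ln n = lang_Lge2 n.
Proof.
rewrite /lang_Ln => _; case: eqP => // ->; apply/seteqP; split=> t.
  move=> [m [tm mmin m_odd]]; exists [tuple m]; split=> //.
    by rewrite /odd_ord even_Ord1 m_odd.
  move=> b; case: b => -[|k [|]]//= _ /wlt_Ord1; exact: mmin.
move=> [[[|m [|]]//= ?] [tm m_odd mmin]]; exists m; split=> //.
  by move=> k km; apply: (mmin [tuple k]); exact/wlt_Ord1.
by apply: contrapT => /negP/even_Ord1/m_odd.
Qed.

(** * The languages L_n *)

Lemma analytic_subtree_lang_L w : analytic [set t | lang_L (subtree t w)].
Proof.
apply: (@analytic_preimage _ _ (@subtree bool ^~ w) _ _ analytic_lang_L).
by apply/continuous_cantorP => t v; exact: near_cantor.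
Qed.

Lemma wadge_lang_Ln_W n (i : nat * nat) : (0 < n)%N ->
  is_index i -> index_le (0, 2) i \/ i = (1, 3) ->
  wadge_le (lang_Ln n) (lang_W i).
Proof.
move=> n0 ii ile; rewrite lang_LnE//.
pose P (a : n.-tuple nat) := [set t | lang_L (subtree t (node a))].
(* With [N a] collecting the earlier subtrees, minimality of [a] becomes the difference of [P a] and
   [N a]; oddness of [Ord a] goes into the index set. *)
pose N (a : n.-tuple nat) :=
  \bigcup_(b in [set b : n.-tuple nat | wlt (Ord b) (Ord a)]) P b.
have [||F Fd FE] := @difference_reduction i _ size _ (n.-tuple nat)
    [set a | odd_ord (Ord a)] P N ii ile.
- by move=> a _; exact: analytic_subtree_lang_L.
- by move=> a _; apply: analytic_bigcup_in => b _; exact: analytic_subtree_lang_L.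
exists F; first exact: delayed_continuous (@finite_rank_size bool) Fd.
rewrite -FE; apply/seteqP; split=> t.
  by move=> [a [ta a_odd amin]]; exists a => //; split=> // -[b /= /amin].
by move=> [a a_odd [ta amin]]; exists a; split=> // b ba tb; apply: amin; exists b.
Qed.

Lemma D_Sigma11_wadge_lang_Ln n (X : topologicalType) (E : set X) : (0 < n)%N ->
  wadge_le E (lang_Ln n) -> D_Sigma11 (omega_pow n) E.
Proof.
move=> n0 [f fc ->]; rewrite lang_LnE//.
pose Q (a : n.-tuple nat) := [set x | lang_L (subtree (f x) (node a))].
(* The union ranges over the tuples with [Ord a] at most [th], which makes the family increasing.
   The first [A th] containing a point is then the one at its least tuple. *)
pose A (th : omega_omega) :=
  \bigcup_(a in [set a : n.-tuple nat | ~ wlt th (Ord a)]) Q a.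
have A_Ord a x : Q a x -> A (Ord a) x by exists a => //; exact: wlt_irr.
exists A; split.
- move=> th _; apply: analytic_bigcup_in => a _.
  exact: analytic_preimage fc (analytic_subtree_lang_L _).
- move=> th' th th'th _ x [a /= ath Qa]; exists a => //= tha.
  by apply: ath; exact: wlt_trans th'th tha.
apply/seteqP; split=> x.
  move=> [a [Qa a_odd amin]]; exists (Ord a); split.
  - exact: Ord_lt_omega_pow.
  - by split=> // _; exact: even_omega_pow.
  - exact: A_Ord.
  move=> th tha [b /= thb Qb]; apply: (amin b) Qb.
  by case: (wlt_total (Ord b) th) => [/wlt_trans|->|//]; exact.
move=> [th [_ [_ th_odd] [a /= tha Qa] thmin]].
have thE : th = Ord a.
  by case: (wlt_total th (Ord a)) => // ath; case: (thmin _ ath); exact: A_Ord.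
exists a; split=> //; first by rewrite -thE; exact/th_odd/even_omega_pow.
by move=> b ba Qb; apply: (thmin (Ord b)); [rewrite thE|exact: A_Ord].
Qed.

Lemma wadge_lang_Ln_D_Sigma11 n (I : Type) (rk : I -> nat) (S : choiceType)
    (E : set (cantor_pow I S)) : (0 < n)%N -> finite_rank rk ->
  D_Sigma11 (omega_pow n) E -> wadge_le E (lang_Ln n).
Proof.
move=> n0 rkf [A [An _ ->]]; rewrite lang_LnE//.
have /(_ _)/cid2-/all_sig2[f fd AE] : forall a : n.-tuple nat,
    exists2 f : cantor_pow I S -> trees bool, delayed rk f &
      A (Ord a) = f @^-1` lang_L.
  by move=> a; apply/analytic_reduction/An/Ord_lt_omega_pow.
(* The tree [f a x] is grafted at [node a], with label 0 elsewhere. Nodes of distinct n-tuples are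
   incomparable, so the grafts do not overlap. *)
pose F x w := `[< exists (a : n.-tuple nat) v, w = node a ++ v /\ f a x v >].
have F_node x (a : n.-tuple nat) : subtree (F x) (node a) = f a x.
  apply/funext => v; apply/asboolP/idP => [[b [v' [/node_cat_inj[]]]]|fv].
    by rewrite !size_tuple.
  - by move=> /val_inj -> ->.
  by exists a, v.
exists (F : cantor_pow I S -> trees bool).
  apply: delayed_continuous rkf _ => x x' w xx'; congr asbool; apply/propext.
  split=> -[a [v [wE fv]]]; exists a, v; split=> //; move: fv;
    rewrite (fd a x x')// => j jv; apply: xx'; rewrite wE size_cat;
    exact: leq_trans jv (leq_addl _ _).
have LF x (a : n.-tuple nat) : lang_L (subtree (F x) (node a)) <-> A (Ord a) x.
  by rewrite F_node AE.
apply/seteqP; split=> x.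
  move=> [th [/lt_omega_powP[a <-] [_ a_odd] Aa amin]]; exists a; split.
  - exact/LF.
  - exact/a_odd/even_omega_pow.
  - by move=> b ba /LF; exact: amin.
move=> [a [/LF Aa a_odd amin]]; exists (Ord a); split=> //.
- exact: Ord_lt_omega_pow.
- by split=> // _; exact: even_omega_pow.
move=> th tha; have [b bE] := lt_omega_powP (wlt_trans tha (Ord_lt_omega_pow a)).
by rewrite -bE => /LF; apply: amin; rewrite bE.
Qed.

Theorem theorem5p10 (n : nat) (i : nat * nat) (hn : (1 <= n)%N)
    (hi : is_index i)
    (hle : index_le (0, 2) i \/ i = (1, 3)) :
  [/\ D_Sigma11_complete (omega_pow n) (lang_Ln n),
      wadge_le (lang_Ln n) (lang_W i)
    & forall alpha : omega_omega, ~ D_Sigma11 alpha (lang_W i)].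
Proof.
split.
- move=> Y E; split; last exact: D_Sigma11_wadge_lang_Ln.
  exact: wadge_lang_Ln_D_Sigma11 hn finite_rank_nat.
- exact: wadge_lang_Ln_W.
- by move=> alpha; exact: not_D_Sigma11_lang_W.
Qed.
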